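(* Let $m,n \geq 2$ be integers. No $m'\times n'$ rectangle with $m' < m$ and $n' < n$ can contain $mn-1$ unit squares with pairwise disjoint interiors.
   Context: Here $m',n'$ are positive real numbers, and the unit squares (closed squares of side length $1$) may be translated and rotated independently. *)

(* Defs.v *)
From mathcomp Require Import all_boot all_order all_algebra.
From mathcomp Require Import all_classical all_reals all_analysis.

Set Implicit Arguments.
Unset Strict Implicit.
Unset Printing Implicit Defensive.

Import Order.TTheory GRing.Theory Num.Theory.
Import numFieldNormedType.Exports.

Local Open Scope classical_set_scope.
Local Open Scope ring_scope.

Definition rotation (R : realType) (theta : R) (p : R * R) : R * R :=
  (p.1 * cos theta - p.2 * sin theta, p.1 * sin theta + p.2 * cos theta).

(* Reflections are not needed: every axis-parallel rectangle is congruent to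
   its mirror images by a translation. *)
Definition is_rectangle (R : realType) (a b : R) (A : set (R * R)) : Prop :=
  exists (theta : R) (v : R * R),
    A = [set rotation theta p + v | p in `[0, a]%classic `*` `[0, b]%classic].

Definition is_unit_square (R : realType) (A : set (R * R)) : Prop :=
  is_rectangle 1 1 A.

(* Main.v *)
(* Place the rectangle as [0, M] x [0, K] with M < m, K < n, no square touching
   the lines y = 0 and y = K. For a square S let A be the area of S below the
   line y = 1 and w the length of its chord on that line. If the centre of S is
   above y = 1 then A <= w / 2; otherwise A <= (1 + w) / 2, and the chord of S
   at height 9/10 is at least 1 long, hence contains in its interior one of the
   m - 1 points (k M / m, 9/10), so that there are at most m - 1 such squares.
   The chords on one line have total length at most M, so the squares cover at
   most (m - 1 + M) / 2 below y = 1; likewise above y = K - 1, and at most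
   M (K - 2) in between. The total m - 1 + M (K - 1) is less than m n - 1. For
   n = 2 every centre is within 1 of the bottom or of the top, which leaves at
   most 2 (m - 1) squares.
   Areas are obtained by integrating chord lengths, so no planar measure is
   needed. *)
Require Import Defs.
From mathcomp Require Import all_boot all_order all_algebra.
From mathcomp Require Import all_classical all_reals all_analysis.
From mathcomp Require Import ring lra.

Set Implicit Arguments.
Unset Strict Implicit.
Unset Printing Implicit Defensive.

Import Order.TTheory GRing.Theory Num.Theory.
Import numFieldNormedType.Exports.

Local Open Scope classical_set_scope.
Local Open Scope ring_scope.

(** * Chord length of a unit square and its area below a line *)

(* A direction [(c, s)] of the first quadrant stands for the unit squares whose
   sides are parallel to [(c, s)] and [(- s, c)]; the vertical extent of such a
   square is [c + s]. *)
Definition direction (R : realFieldType) (c s : R) : Prop :=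
  [/\ 0 <= c, 0 <= s & c ^+ 2 + s ^+ 2 = 1].

(** Positive part. Signed sums of its translates give the trapezoidal graph of the chord length of
    an oblique square, and signed sums of their squares its integral. *)
Definition ramp (R : realFieldType) (x : R) : R := Num.max x 0.

(* Length of the intersection of the square centred at the origin with the line
   at height [u]. For an axis-parallel square the jump is resolved to [0]. *)
Definition chord (R : realFieldType) (c s u : R) : R :=
  if c * s == 0 then (if `|u| < 1 / 2 then 1 else 0)
  else (ramp (u + (c + s) / 2) - ramp (u + (c - s) / 2)
        - ramp (u - (c - s) / 2) + ramp (u - (c + s) / 2)) / (c * s).

(* Area of the part of the square centred at the origin below height [u]; its
   derivative in [u] is [chord c s u]. *)
Definition area (R : realFieldType) (c s u : R) : R :=
  if c * s == 0 then ramp (u + 1 / 2) - ramp (u - 1 / 2)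
  else (ramp (u + (c + s) / 2) ^+ 2 - ramp (u + (c - s) / 2) ^+ 2
        - ramp (u - (c - s) / 2) ^+ 2 + ramp (u - (c + s) / 2) ^+ 2)
       / (2 * (c * s)).

Lemma rampP (R : realFieldType) (x : R) :
  (0 <= x /\ ramp x = x) \/ (x <= 0 /\ ramp x = 0).
Proof. by rewrite /ramp; case: (leP 0 x) => [h|/ltW h]; [left|right]. Qed.

Lemma direction_sym (R : realFieldType) (c s : R) :
  direction c s -> direction s c.
Proof. by case=> c0 s0 cs; split=> //; rewrite addrC. Qed.

Lemma chord_sym (R : realFieldType) (c s u : R) : chord c s u = chord s c u.
Proof.
rewrite /chord (mulrC s c) (addrC s c) -(opprB c s) !mulNr opprK.
by case: ifP => // _; congr (_ / _); ring.
Qed.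

Lemma area_sym (R : realFieldType) (c s u : R) : area c s u = area s c u.
Proof.
rewrite /area (mulrC s c) (addrC s c) -(opprB c s) !mulNr opprK.
by case: ifP => // _; congr (_ / _); ring.
Qed.

Lemma direction_eq1 (R : realFieldType) (c s : R) : direction c s ->
  c * s = 0 -> (c = 1 /\ s = 0) \/ (c = 0 /\ s = 1).
Proof.
move=> [c0 s0 cs] /eqP; rewrite mulf_eq0 => /orP[/eqP e|/eqP e]; subst;
  [right|left]; split=> //; apply/eqP; rewrite -sqrp_eq1 //; apply/eqP;
  move: cs; rewrite expr0n /=; lra.
Qed.

Lemma rampN (R : realFieldType) (x : R) : ramp (- x) = ramp x - x.
Proof.
by case: (rampP (- x)) => [][? ->]; case: (rampP x) => [][? ->]; lra.
Qed.

Lemma ramp_sqrN (R : realFieldType) (x : R) :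
  ramp (- x) ^+ 2 = x ^+ 2 - ramp x ^+ 2.
Proof.
rewrite rampN; case: (rampP x) => [][? ->]; ring.
Qed.

Lemma chordN (R : realFieldType) (c s u : R) : chord c s (- u) = chord c s u.
Proof.
rewrite /chord normrN; case: ifP => // _; congr (_ / _).
have -> : - u + (c + s) / 2 = - (u - (c + s) / 2) by ring.
have -> : - u + (c - s) / 2 = - (u - (c - s) / 2) by ring.
have -> : - u - (c + s) / 2 = - (u + (c + s) / 2) by ring.
have -> : - u - (c - s) / 2 = - (u + (c - s) / 2) by ring.
by rewrite !rampN; ring.
Qed.

(** The half-turn about the centre carries the part below [- u] to the part above [u], and the whole
    area is 1. Bounds at the bottom thus transfer to the top. *)
Lemma areaN (R : realFieldType) (c s u : R) :
  area c s (- u) = 1 - area c s u.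
Proof.
rewrite /area; case: ifPn => [_|cs0].
  have -> : - u + 1 / 2 = - (u - 1 / 2) by ring.
  have -> : - u - 1 / 2 = - (u + 1 / 2) by ring.
  by rewrite !rampN; field.
have -> : - u + (c + s) / 2 = - (u - (c + s) / 2) by ring.
have -> : - u + (c - s) / 2 = - (u - (c - s) / 2) by ring.
have -> : - u - (c + s) / 2 = - (u + (c + s) / 2) by ring.
have -> : - u - (c - s) / 2 = - (u + (c - s) / 2) by ring.
rewrite !ramp_sqrN; field.
by move: cs0; rewrite mulf_eq0 negb_or => /andP[-> ->].
Qed.

(** The vertices have heights [(c + s) / 2] and [(c - s) / 2] up to sign. As the line rises through
    the square, it first cuts off a triangle at the lowest corner, then has constant chord [1 / c],
    and finally leaves a triangle at the highest corner. *)
Lemma chord_area_cases (R : realFieldType) (c s u : R) : 0 < s -> s <= c ->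
  [\/ [/\ u <= - ((c + s) / 2), chord c s u = 0 & area c s u = 0],
      [/\ - ((c + s) / 2) <= u <= - ((c - s) / 2),
          chord c s u = (u + (c + s) / 2) / (c * s)
        & area c s u = (u + (c + s) / 2) ^+ 2 / (2 * (c * s))],
      [/\ - ((c - s) / 2) <= u <= (c - s) / 2,
          chord c s u = c^-1 & area c s u = 1 / 2 + u / c]
    | (c - s) / 2 <= u /\
      (([/\ u <= (c + s) / 2,
          chord c s u = ((c + s) / 2 - u) / (c * s)
        & area c s u = 1 - ((c + s) / 2 - u) ^+ 2 / (2 * (c * s))]) \/
       [/\ (c + s) / 2 <= u, chord c s u = 0 & area c s u = 1])].
Proof.
move=> s0 sc; have c0 : 0 < c by lra.
have cs0 : c * s != 0 by rewrite mulf_neq0 // gt_eqF.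
have c0' : c != 0 by rewrite gt_eqF.
have s0' : s != 0 by rewrite gt_eqF.
rewrite /chord /area (negbTE cs0).
have pE (x : R) : 0 <= x -> ramp x = x by move=> ?; rewrite /ramp max_l.
have nE (x : R) : x <= 0 -> ramp x = 0 by move=> ?; rewrite /ramp max_r.
case: (leP u (- ((c + s) / 2))) => h1.
  apply: Or41; split=> //.
    by rewrite !nE; try lra; rewrite !subr0 addr0 mul0r.
  by rewrite !nE; try lra; rewrite expr0n !subr0 addr0 mul0r.
case: (leP u (- ((c - s) / 2))) => h2.
  apply: Or42; split; first lra.
    rewrite (pE (u + (c + s) / 2)); last lra.
    by rewrite !nE; try lra; rewrite !subr0 addr0.
  rewrite (pE (u + (c + s) / 2)); last lra.
  by rewrite !nE; try lra; rewrite expr0n !subr0 addr0.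
case: (leP u ((c - s) / 2)) => h3.
  apply: Or43; split; first lra;
    rewrite (pE (u + (c + s) / 2)); try lra;
    rewrite (pE (u + (c - s) / 2)); try lra;
    rewrite !nE; try lra; field; rewrite ?c0' ?s0' //.
apply: Or44; split; first lra.
case: (leP u ((c + s) / 2)) => h4; [left|right]; (split; first lra);
    rewrite (pE (u + (c + s) / 2)); try lra;
    rewrite (pE (u + (c - s) / 2)); try lra;
    rewrite (pE (u - (c - s) / 2)); try lra.
- by rewrite nE; try lra; field; rewrite ?c0' ?s0'.
- by rewrite nE; try lra; field; rewrite ?c0' ?s0'.
- by rewrite pE; try lra; field; rewrite ?c0' ?s0'.
- by rewrite pE; try lra; field; rewrite ?c0' ?s0'.
Qed.

(** * Inequalities between area and chord *)

Lemma direction_bounds (R : realFieldType) (c s : R) : direction c s ->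
  [/\ c <= 1, s <= 1, 1 <= c + s & (c + s) ^+ 2 = 1 + 2 * (c * s)].
Proof.
move=> [c0 s0 cs]; have h : 0 <= c * s by rewrite mulr_ge0.
by split; [nra|nra|nra|rewrite sqrrD -mulr_natl; lra].
Qed.

Lemma chord_ge0 (R : realFieldType) (c s u : R) :
  direction c s -> 0 <= chord c s u.
Proof.
move=> d; wlog sc : c s d / s <= c.
  move=> H; case: (leP s c) => [|/ltW];
    [exact: H|move/(H _ _ (direction_sym d))].
  by rewrite chord_sym.
have [c0 s0 cs] := d.
have [s1|s1] := eqVneq s 0.
  by rewrite /chord s1 mulr0 eqxx; case: ifP.
have s2 : 0 < s by rewrite lt_def s1.
have cs1 : 0 <= c * s by rewrite mulr_ge0.
case: (chord_area_cases u s2 sc) =>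
  [[_ -> _]|[? -> _]|[_ -> _]|
   [_ [[? -> _]|[_ -> _]]]] //.
- by apply: divr_ge0 => //; lra.
- by rewrite invr_ge0.
- by apply: divr_ge0 => //; lra.
Qed.

(** A triangular part has area half its base times its height, and that height is at most 1. In the
    middle range the area is below 1/2, the line being under the centre, while the chord [1 / c] is
    at least 1. *)
Lemma area_le_halfchord (R : realFieldType) (c s u : R) :
  direction c s -> u < 0 -> area c s u <= chord c s u / 2.
Proof.
move=> d u0; wlog sc : c s d / s <= c.
  move=> H; case: (leP s c) => [|/ltW];
    [exact: H|move/(H _ _ (direction_sym d))].
  by rewrite chord_sym area_sym.
have [c0 s0 cs] := d; have [c1 s1 _ h2] := direction_bounds d.
have [s2|s2] := eqVneq s 0.
  rewrite /chord /area s2 mulr0 eqxx.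
  case: (rampP (u + 1 / 2)) => [][? ->];
  case: (rampP (u - 1 / 2)) => [][? ->];
  case: (ltrP `|u|) => [/ltr_normlP[? ?]|]; rewrite ?ler_normr;
  try (case/orP => ?); lra.
have s3 : 0 < s by rewrite lt_def s2.
have c3 : 0 < c by lra.
have cs1 : 0 < c * s by rewrite mulr_gt0.
case: (chord_area_cases u s3 sc) =>
  [[_ -> ->]|[? -> ->]|[_ -> ->]|
   [? _]] //; try lra.
  set z := u + _; have z0 : 0 <= z by rewrite /z; lra.
  have z1 : z <= 1 by rewrite /z; nra.
  have -> : z ^+ 2 / (2 * (c * s)) = z * (z / (c * s) / 2).
    by field; rewrite s2 gt_eqF.
  apply: ler_piMl => //; apply: divr_ge0 => //; apply: divr_ge0 => //; lra.
have : u / c < 0 by rewrite pmulr_llt0 ?invr_gt0.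
have : 1 <= c^-1 by rewrite invr_ge1 ?unitfE ?gt_eqF.
lra.
Qed.

Lemma area_le1 (R : realFieldType) (c s u : R) :
  direction c s -> area c s u <= 1.
Proof.
move=> d; wlog sc : c s d / s <= c.
  move=> H; case: (leP s c) => [|/ltW];
    [exact: H|move/(H _ _ (direction_sym d))].
  by rewrite area_sym.
have [c0 s0 cs] := d; have [c1 s1 _ h2] := direction_bounds d.
have [s2|s2] := eqVneq s 0.
  rewrite /area s2 mulr0 eqxx.
  case: (rampP (u + 1 / 2)) => [][? ->];
  case: (rampP (u - 1 / 2)) => [][? ->]; lra.
have s3 : 0 < s by rewrite lt_def s2.
have c3 : 0 < c by lra.
have cs1 : 0 < c * s by rewrite mulr_gt0.
case: (chord_area_cases u s3 sc) =>
  [[_ _ ->]|[? _ ->]|[? _ ->]|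
   [? [[? _ ->]|[_ _ ->]]]] //; try lra.
- rewrite ler_pdivrMr; nra.
- have : u / c <= 1 / 2 by rewrite ler_pdivrMr //; lra.
  lra.
- rewrite lerBlDr lerDl; apply: divr_ge0; first exact: sqr_ge0; lra.
Qed.

(** The square lies above height 0 and its centre, at height [b], is not above the line at height 1.
    In the middle range it is enough that the area is at most 1 and the chord at least 1; the
    decisive case is a line leaving a triangle at the top. *)
Lemma area_le_chord (R : realFieldType) (c s b : R) : direction c s ->
  (c + s) / 2 < b -> b <= 1 -> area c s (1 - b) <= (1 + chord c s (1 - b)) / 2.
Proof.
move=> d b0 b1; wlog sc : c s d b0 / s <= c.
  move=> H; case: (leP s c) => [|/ltW];
    [exact: H|move/(H _ _ (direction_sym d))].
  by rewrite chord_sym area_sym addrC; apply.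
have [c0 s0 cs] := d; have [c1 s1 h1 h2] := direction_bounds d.
have [s2|s2] := eqVneq s 0.
  have ? : c = 1 by nra.
  rewrite /chord /area s2 mulr0 eqxx.
  case: (rampP (1 - b + 1 / 2)) => [][? ->];
  case: (rampP (1 - b - 1 / 2)) => [][? ->];
  case: (ltrP `|1 - b|) => [/ltr_normlP[? ?]|]; rewrite ?ler_normr;
  try (case/orP => ?); lra.
have s3 : 0 < s by rewrite lt_def s2.
have c3 : 0 < c by lra.
have cs1 : 0 < c * s by rewrite mulr_gt0.
have := area_le1 (1 - b) d.
case: (chord_area_cases (1 - b) s3 sc) =>
  [[? -> ->]|[? -> ->]|[? -> ->]|
   [? [[? -> ->]|[? -> ->]]]]; try lra.
- move=> _; set z := 1 - b + _; have z0 : 0 <= z by rewrite /z; lra.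
  have z1 : z <= 1 by rewrite /z; nra.
  have -> : z ^+ 2 / (2 * (c * s)) = z * (z / (c * s) / 2).
    by field; rewrite s2 gt_eqF.
  have : 0 <= z / (c * s) / 2 by rewrite !divr_ge0 //; lra.
  nra.
- have : 1 <= c^-1 by rewrite invr_ge1 ?unitfE ?gt_eqF.
  lra.
(* [z] is the height of the triangle above the line. Since [z * (z + 1)] is at least [(c + s - 1) *
   (c + s) = 1 + 2 * c * s - (c + s)], the claim [c * s <= z * (z + 1)] follows from
   [0 <= (1 - c) * (1 - s)]. *)
- move=> _; set z := _ - (1 - b); have z0 : c + s - 1 <= z by rewrite /z; lra.
  suff : 1 <= z ^+ 2 / (c * s) + z / (c * s).
    have -> : z ^+ 2 / (2 * (c * s)) = (z ^+ 2 / (c * s)) / 2.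
      by field; rewrite s2 gt_eqF.
    lra.
  rewrite -mulrDl ler_pdivlMr //; nra.
Qed.

(* The height 9/10 works because [c + s - c * s] is at least
   [sqrt 2 - 1 / 2 = 0.914...]. *)
Lemma chord_ge1 (R : realFieldType) (c s b : R) : direction c s ->
  (c + s) / 2 < b -> b <= 1 -> 1 <= chord c s (9 / 10 - b).
Proof.
move=> d b0 b1; wlog sc : c s d b0 / s <= c.
  move=> H; case: (leP s c) => [|/ltW];
    [exact: H|move/(H _ _ (direction_sym d))].
  by rewrite chord_sym addrC; apply.
have [c0 s0 cs] := d; have [c1 s1 h1 h2] := direction_bounds d.
have [s2|s2] := eqVneq s 0.
  have ? : c = 1 by nra.
  rewrite /chord s2 mulr0 eqxx; case: ltrP => //.
  by rewrite ler_normr => /orP[] ?; lra.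
have s3 : 0 < s by rewrite lt_def s2.
have c3 : 0 < c by lra.
have cs1 : 0 < c * s by rewrite mulr_gt0.
(* With [t = c + s], the case of a triangle at the top needs [t ^+ 2 - 2 * t + 4 / 5 <= 0], whose
   larger root is 1.447...; the constant 1.44 lies between sqrt 2 and that root. *)
have h3 : c + s <= 144 / 100 by nra.
case: (chord_area_cases (9 / 10 - b) s3 sc) =>
  [[? -> _]|[? -> _]|[? -> _]|
   [? [[? -> _]|[? -> _]]]]; try lra.
- rewrite ler_pdivlMr //; nra.
- by rewrite invr_ge1 ?unitfE ?gt_eqF.
- rewrite ler_pdivlMr //; nra.
Qed.

(** * The chord as an interval inside the square *)

Definition in_open_square (R : realFieldType) (c s x y : R) : Prop :=
  `|c * x + s * y| < 1 / 2 /\ `|c * y - s * x| < 1 / 2.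

(** The line at height [u] meets the two strips bounded by opposite sides in two intervals. The four
    bounds are the differences between a right end and a left end of these intervals, cleared of
    denominators. *)
Lemma chord_bounds (R : realFieldType) (c s u : R) :
  direction c s -> 0 < c -> 0 < s -> 0 < chord c s u ->
  [/\ c * chord c s u <= 1, s * chord c s u <= 1,
      c * s * chord c s u <= (c + s) / 2 - u
    & c * s * chord c s u <= (c + s) / 2 + u].
Proof.
move=> d c0 s0; wlog sc : c s d c0 s0 / s <= c.
  move=> H; case: (leP s c) => [|/ltW]; first exact: H.
  move/(H _ _ (direction_sym d) s0 c0).
  rewrite chord_sym (mulrC s c) (addrC s c).
  by move=> /[apply] -[].
have [c1 s1 h1 h2] := direction_bounds d.
have cs1 : 0 < c * s by rewrite mulr_gt0.
have zE (z : R) : c * (z / (c * s)) = z / s by field; rewrite !gt_eqF.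
have zE' (z : R) : s * (z / (c * s)) = z / c by field; rewrite !gt_eqF.
have zE2 (z : R) : c * s * (z / (c * s)) = z by field; rewrite !gt_eqF.
case: (chord_area_cases u s0 sc) =>
  [[? -> _]|[? -> _]|[? -> _]|
   [? [[? -> _]|[? -> _]]]];
  rewrite ?ltxx // => k0.
- rewrite zE zE' zE2 ler_pdivrMr // ler_pdivrMr //; split; lra.
- rewrite mulfV ?gt_eqF // mulrAC mulfV ?gt_eqF // ler_pdivrMr //; split; lra.
- rewrite zE zE' zE2 ler_pdivrMr // ler_pdivrMr //; split; lra.
Qed.

Lemma chord_interval (R : realFieldType) (c s u : R) : direction c s ->
  exists l, forall x, l < x < l + chord c s u -> in_open_square c s x u.
Proof.
move=> d; have [c0 s0 cs] := d.
have [cs0|cs0] := eqVneq (c * s) 0.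
  exists (- 1 / 2) => x; rewrite /chord cs0 eqxx.
  case: (ltrP `|u|) => h; last by case/andP; lra.
  move=> /andP[x1 x2]; rewrite /in_open_square.
  have hx : `|x| < 1 / 2 by rewrite ltr_norml; lra.
  by case: (direction_eq1 d cs0) => -[-> ->];
    rewrite !mul0r ?addr0 ?add0r ?subr0 ?sub0r (mul1r x) (mul1r u) ?normrN.
have c1 : 0 < c.
  by rewrite lt_def c0 andbT; apply: contraNneq cs0 => ->; rewrite mul0r.
have s1 : 0 < s.
  by rewrite lt_def s0 andbT; apply: contraNneq cs0 => ->; rewrite mulr0.
(* Left ends of the two strips on this line; the larger one is the left end of the chord. *)
pose l1 := (- 1 / 2 - s * u) / c; pose l2 := (c * u - 1 / 2) / s.
have l1E : c * l1 = - 1 / 2 - s * u by rewrite /l1; field; rewrite gt_eqF.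
have l2E : s * l2 = c * u - 1 / 2 by rewrite /l2; field; rewrite gt_eqF.
exists (Num.max l1 l2) => x /andP[]; rewrite gt_max => /andP[x1 x2] x3.
have k0 : 0 < chord c s u by move: x3; rewrite /Num.max; case: ifP; lra.
have [k1 k2 k3 k4] := chord_bounds d c1 s1 k0.
move: (chord c s u) x3 k0 k1 k2 k3 k4 => k x3 k0 k1 k2 k3 k4.
have y1 : c * l1 < c * x by rewrite ltr_pM2l.
have y2 : s * l2 < s * x by rewrite ltr_pM2l.
have csl1 : c * (s * l1) = s * (- 1 / 2 - s * u) by rewrite -l1E; ring.
have csl2 : s * (c * l2) = c * (c * u - 1 / 2) by rewrite -l2E; ring.
have [u1 u2] : c * x < 1 / 2 - s * u /\ s * x < c * u + 1 / 2.
  move: x3; rewrite /Num.max; case: (ltrP l1 l2) => _ x3.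
    have a1 : s * x < s * (l2 + k) by rewrite ltr_pM2l.
    have a2 : s * (c * x) < s * (c * (l2 + k)) by rewrite !ltr_pM2l.
    have a3 : c * s * k <= c * (1 / 2) + s * (1 / 2) - (c ^+ 2 + s ^+ 2) * u.
      by rewrite cs; lra.
    split; last by lra.
    by rewrite -(ltr_pM2l s1); lra.
  have a1 : c * x < c * (l1 + k) by rewrite ltr_pM2l.
  have a2 : c * (s * x) < c * (s * (l1 + k)) by rewrite !ltr_pM2l.
  have a3 : c * s * k <= c * (1 / 2) + s * (1 / 2) + (c ^+ 2 + s ^+ 2) * u.
    by rewrite cs; lra.
  split; first by lra.
  by rewrite -(ltr_pM2l c1); lra.
by split; rewrite ltr_norml; lra.
Qed.

(** * Total length of disjoint intervals *)

Lemma sum_disjoint_itv_le (R : realType) (N : nat) (l w : 'I_N -> R) (M : R) :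
  0 <= M -> (forall i, 0 <= w i) ->
  (forall i x, l i < x < l i + w i -> 0 <= x <= M) ->
  (forall i j x, l i < x < l i + w i -> l j < x < l j + w j -> i = j) ->
  \sum_i w i <= M.
Proof.
move=> M0 w0 inM disj.
pose I i : set R := `]l i, l i + w i[%classic.
have muI i : lebesgue_measure (I i) = (w i)%:E.
  rewrite lebesgue_measure_itv /= lte_fin ltrDl.
  case: ltrP => wi; first by rewrite -EFinB addrAC subrr add0r.
  by congr EFin; apply/eqP; rewrite eq_le wi w0.
have : (lebesgue_measure (\big[setU/set0]_(i < N) I i)
          <= lebesgue_measure (`[0%R, M]%classic : set R))%E.
  apply: le_measure; rewrite ?inE //.
  - by apply: bigsetU_measurable => i _; exact: measurable_itv.
  - rewrite -bigcup_seq => x [i _]; rewrite /I /= !in_itv /=.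
    exact: inM.
rewrite measure_bigsetU_ord //; last 2 first.
- by move=> i; exact: measurable_itv.
- move=> i j _ _ [x]; rewrite /I /= !in_itv /= => -[]; exact: disj.
rewrite (eq_bigr (fun i => (w i)%:E)); last by move=> i _; exact: muI.
rewrite sumEFin lebesgue_measure_itv /= lte_fin sube0.
by case: (ltrP 0 M) => _; rewrite lee_fin // => /le_trans; apply.
Qed.

(** * Area as an antiderivative of chord length *)

(** Induction on the exceptional points, splitting [[a, b]] at each one inside it. They are there
    because the area of an axis-parallel square is not differentiable at the heights of its
    horizontal sides. *)
Lemma le_of_derive_le0_off_seq (R : realType) (f df : R -> R) (D : seq R)
    (a b : R) : a <= b -> continuous f ->
  (forall x, a < x < b -> x \notin D -> is_derive x 1 f (df x)) ->
  (forall x, a < x < b -> x \notin D -> df x <= 0) -> f b <= f a.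
Proof.
move=> ab fc; elim: D a b ab => [|d D IH] a b ab hf hd.
  apply: (@ler0_derive1_le_cc _ f a b); rewrite ?in_itv /= ?lexx ?ab //.
  - by move=> x; rewrite in_itv /= => xab; have [] := hf x xab isT.
  - move=> x; rewrite in_itv /= => xab.
    rewrite derive1E; have -> := @derive_val _ _ _ _ _ _ _ (hf x xab isT).
    exact: hd.
  - exact: continuous_subspaceT.
have sub a' b' : a <= a' -> b' <= b -> ~~ (a' < d < b') -> a' <= b' ->
    f b' <= f a'.
  move=> aa bb nd ab'; apply: IH => // x /andP[x1 x2] xD.
    apply: hf; first by rewrite (le_lt_trans aa) ?(lt_le_trans x2).
    rewrite inE negb_or xD andbT; apply: contraNneq nd => <-.
    by rewrite x1 x2.
  apply: hd; first by rewrite (le_lt_trans aa) ?(lt_le_trans x2).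
  rewrite inE negb_or xD andbT; apply: contraNneq nd => <-.
  by rewrite x1 x2.
case: (boolP (a < d < b)) => [/andP[ad db]|]; last by move=> h; apply: sub.
by apply: (@le_trans _ _ (f d)); apply: sub; rewrite ?ltxx ?andbF // ltW.
Qed.

Lemma continuous_ramp (R : realType) : continuous (@ramp R).
Proof.
move=> x; apply: continuous_max; [exact: cvg_id | exact: cvg_cst].
Qed.

Lemma is_derive_ramp (R : realType) (x : R) : x != 0 ->
  is_derive x 1 (@ramp R) (if 0 < x then 1 else 0).
Proof.
move=> x0; case: (ltrP 0 x) => [h|].
  apply: (@near_eq_is_derive _ _ _ id).
  by apply: filterS (lt_nbhsr h) => z z0; rewrite /ramp max_l // ltW.
rewrite le_eqVlt (negbTE x0) /= => h.
apply: (@near_eq_is_derive _ _ _ (cst 0)).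
by apply: filterS (lt_nbhsl h) => z z0; rewrite /ramp max_r // ltW.
Qed.

Lemma is_derive_comp_shift (R : realType) (f : R -> R) (k x df : R) :
  is_derive (x + k) 1 f df -> is_derive x 1 (fun y => f (y + k)) df.
Proof.
move=> fd.
have := @is_derive1_comp _ f (shift k) x df 1 fd (is_derive_shift x 1 k).
by rewrite mulr1.
Qed.

Lemma is_derive_ramp_sqr (R : realType) (x : R) : x != 0 ->
  is_derive x 1 (fun y => ramp y ^+ 2) (2 * ramp x).
Proof.
move=> x0; have h := is_deriveX 2 (is_derive_ramp x0).
apply: is_derive_eq h _; rewrite /GRing.scale /= expr1 /ramp.
by case: (ltrP 0 x) => x1; rewrite ?mulr1 ?mulr0 // mulr0.
Qed.

(** Heights of the four vertices. *)
Definition kinks (R : realFieldType) (c s : R) : seq R :=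
  [:: - ((c + s) / 2); - ((c - s) / 2); (c - s) / 2; (c + s) / 2].

Lemma is_derive_area (R : realType) (c s u : R) : direction c s ->
  u \notin kinks c s -> is_derive u 1 (area c s) (chord c s u).
Proof.
move=> d; rewrite !inE !negb_or => /and4P[u1 u2 u3 u4].
have v1 : u + (c + s) / 2 != 0 by rewrite addr_eq0.
have v2 : u + (c - s) / 2 != 0 by rewrite addr_eq0.
have v3 : u - (c - s) / 2 != 0 by rewrite subr_eq0.
have v4 : u - (c + s) / 2 != 0 by rewrite subr_eq0.
have [cs0|cs0] := eqVneq (c * s) 0.
  have [w1 w2] : u + 1 / 2 != 0 /\ u - 1 / 2 != 0.
    case: (direction_eq1 d cs0) => -[ec es]; move: v1 v4;
      by rewrite ec es ?addr0 ?add0r.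
  have h := is_deriveB (is_derive_comp_shift (is_derive_ramp w1))
                       (is_derive_comp_shift (is_derive_ramp w2)).
  rewrite /chord /area cs0 eqxx; apply: is_derive_eq h _.
  move: w1 w2; rewrite addr_eq0 subr_eq0 => w1 w2.
  case: (ltrP 0 (u + 1 / 2)); case: (ltrP 0 (u - 1 / 2)); case: (ltrP `|u|);
    rewrite ?ltr_norml ?ler_normr; try lra.
rewrite /chord /area (negbTE cs0).
have h := is_deriveD (is_deriveB (is_deriveB
  (is_derive_comp_shift (is_derive_ramp_sqr v1))
  (is_derive_comp_shift (is_derive_ramp_sqr v2)))
  (is_derive_comp_shift (is_derive_ramp_sqr v3)))
  (is_derive_comp_shift (is_derive_ramp_sqr v4)).
have := is_deriveM h (is_derive_cst (2 * (c * s))^-1 u 1).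
move=> h'; apply: is_derive_eq h' _.
rewrite /GRing.scale /= mulr0 add0r; field.
by move: cs0; rewrite mulf_eq0 negb_or => /andP[-> ->].
Qed.

Lemma continuous_area (R : realType) (c s : R) : continuous (area c s).
Proof.
have r k : continuous (fun u : R => ramp (u + k)).
  move=> u; apply: (@continuous_comp _ _ _ (fun u => u + k) (@ramp R)).
    by apply: continuousD; [exact: cvg_id | exact: cvg_cst].
  exact: continuous_ramp.
have r2 k : continuous (fun u : R => ramp (u + k) ^+ 2).
  by move=> u; apply: (@continuousM _ _ (fun u => ramp (u + k))); exact: r.
rewrite /area; case: (c * s == 0) => u /=.
  exact: (continuousB (r (1 / 2) u) (r (- (1 / 2)) u)).
pose h := (c + s) / 2; pose d := (c - s) / 2.
have := continuousM (continuousD (continuousB (continuousB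
  (r2 h u) (r2 d u)) (r2 (- d) u)) (r2 (- h) u))
  (@cst_continuous _ _ (2 * (c * s))^-1 u).
exact.
Qed.

(** * Counting long disjoint intervals *)

(** Pigeonhole on the [m - 1] points [d, 2 d, ..., (m - 1) d] with [d = M / m < 1]: an interval of
    length at least 1 has the first multiple of [d] beyond its left end in its interior, and
    disjoint intervals have different ones. *)
Lemma card_disjoint_itv_ge1 (R : realType) (N m : nat) (M : R)
    (P : pred 'I_N) (l w : 'I_N -> R) :
  (2 <= m)%N -> 0 < M -> M < m%:R -> (forall i, P i -> 1 <= w i) ->
  (forall i x, l i < x < l i + w i -> 0 <= x <= M) ->
  (forall i j x, l i < x < l i + w i -> l j < x < l j + w j -> i = j) ->
  (#|P| <= m.-1)%N.
Proof.
case: m => [|[|k]] // _ M0 Mm w1 inM disj; rewrite -[k.+2.-1]card_ord.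
pose d := M / k.+2%:R.
have d0 : 0 < d by rewrite divr_gt0.
have d1 : d < 1 by rewrite ltr_pdivrMr // mul1r.
have Md : M = k.+2%:R * d by rewrite /d mulrC divfK.
pose f i := Num.trunc (l i / d).
have l0 i : P i -> 0 <= l i.
  move=> /w1 wi; rewrite leNgt; apply/negP => li.
  (* Midpoint of the part of the interval left of 0. *)
  have /andP[+ _] : 0 <= (l i + Num.min 0 (l i + w i)) / 2 <= M.
    by apply: (inM i); case: (ltrP 0 (l i + w i)); lra.
  by case: (ltrP 0 (l i + w i)); lra.
have lM i : P i -> l i + w i <= M.
  move=> /w1 wi; rewrite leNgt; apply/negP => li.
  have /andP[_] : 0 <= (l i + w i + Num.max M (l i)) / 2 <= M.
    by apply: (inM i); case: (ltrP M (l i)); lra.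
  by case: (ltrP M (l i)); lra.
have fP i : P i -> l i < (f i).+1%:R * d < l i + w i.
  move=> Pi; have /truncn_itv/andP[h1 h2] : 0 <= l i / d.
    by rewrite divr_ge0 ?l0 // ltW.
  move: h1 h2; rewrite -/(f i) ler_pdivlMr // ltr_pdivrMr // => h1 ->.
  by rewrite -natr1 mulrDl mul1r; have := w1 i Pi; lra.
have fk i : P i -> (f i < k.+1)%N.
  move=> Pi; rewrite -ltnS -(ltr_nat R) -(ltr_pM2r d0) -Md.
  by case/andP: (fP i Pi) => _ /lt_le_trans; apply; exact: lM.
apply: (@leq_card_in _ _ (fun i => inord (f i) : 'I_k.+1)) => i j Pi Pj.
move/(congr1 (@nat_of_ord _)); rewrite !inordK ?fk // => fij.
by apply: (disj i j ((f i).+1%:R * d)); [|rewrite fij]; exact: fP.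
Qed.

(** * Disjoint squares in a vertical strip of width [M] *)

Section Packing.
Variables (R : realType) (N : nat) (M : R) (c s a b : 'I_N -> R).
Hypothesis M0 : 0 < M.
Hypothesis dcs : forall i, direction (c i) (s i).
Hypothesis inM : forall i x y,
  in_open_square (c i) (s i) (x - a i) (y - b i) -> 0 <= x <= M.
Hypothesis disj : forall i j x y,
  in_open_square (c i) (s i) (x - a i) (y - b i) ->
  in_open_square (c j) (s j) (x - a j) (y - b j) -> i = j.

Lemma line_intervals (y : R) : exists l : 'I_N -> R,
  forall i x, l i < x < l i + chord (c i) (s i) (y - b i) ->
    in_open_square (c i) (s i) (x - a i) (y - b i).
Proof.
have [l lP] := choice (fun i => chord_interval (y - b i) (dcs i)).
by exists (fun i => l i + a i) => i x h; apply: lP; lra.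
Qed.

Lemma sum_chord_le (y : R) : \sum_i chord (c i) (s i) (y - b i) <= M.
Proof.
have [l lP] := line_intervals y.
apply: (sum_disjoint_itv_le (l := l)); first exact: ltW.
- by move=> i; apply: chord_ge0.
- by move=> i x /lP; exact: inM.
- by move=> i j x /lP + /lP; exact: disj.
Qed.

Lemma card_chord_ge1 (m : nat) (y : R) (P : pred 'I_N) :
  (2 <= m)%N -> M < m%:R ->
  (forall i, P i -> 1 <= chord (c i) (s i) (y - b i)) -> (#|P| <= m.-1)%N.
Proof.
move=> m2 Mm hP; have [l lP] := line_intervals y.
apply: (card_disjoint_itv_ge1 (l := l) m2 M0 Mm hP).
- by move=> i x /lP; exact: inM.
- by move=> i j x /lP + /lP; exact: disj.
Qed.

(** Away from the vertex heights, collected in [D], the total area below [y] grows at the rate of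
    the total chord length, which is at most [M]. *)
Lemma sum_area_le (y1 y2 : R) : y1 <= y2 ->
  \sum_i area (c i) (s i) (y2 - b i) - \sum_i area (c i) (s i) (y1 - b i)
    <= M * (y2 - y1).
Proof.
move=> y12.
pose f i (y : R) := area (c i) (s i) (y - b i).
pose F (y : R) := \sum_i f i y - M * y.
pose D := [seq k + b i | i <- enum 'I_N, k <- kinks (c i) (s i)].
suff : F y2 <= F y1 by rewrite /F; lra.
apply: (@le_of_derive_le0_off_seq _ F
  (fun y => \sum_i chord (c i) (s i) (y - b i) - M) D) => //.
- move=> y; apply: continuousB.
    apply: cvg_big => [|i _]; first exact: add_continuous.
    apply: (@continuous_comp _ _ _ (fun u => u - b i) (area (c i) (s i))).
      by apply: continuousB; [exact: cvg_id | exact: cvg_cst].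
    exact: continuous_area.
  by apply: continuousM; [exact: cvg_cst | exact: cvg_id].
- move=> y _ yD.
  have hi i : is_derive y 1 (f i) (chord (c i) (s i) (y - b i)).
    apply: is_derive_comp_shift; apply: is_derive_area => //.
    apply: contra yD => h; apply/allpairsPdep.
    by exists i, (y - b i); rewrite mem_enum subrK.
  have h1 := is_derive_sum hi.
  have h2 : is_derive y 1 (fun y : R => M * y) M.
    have h3 := is_deriveM (is_derive_cst M y 1) (is_derive_id y 1).
    by apply: is_derive_eq h3 _; rewrite /GRing.scale /= mulr1 mulr0 addr0.
  have := is_deriveB h1 h2; congr (is_derive _ _ _ _).
  by apply/funext => z; rewrite /F /= fct_sumE.
- by move=> y _ _; rewrite subr_le0 sum_chord_le.
Qed.

(** The condition [2 <= K] keeps the line [y = 1] at or below the line [y = K - 1], between which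
    [sum_area_le] is applied. *)
Lemma packing_bound (m n : nat) (K : R) :
  (2 <= m)%N -> (2 <= n)%N -> M < m%:R -> K < n%:R ->
  ((3 <= n)%N -> 2 <= K) ->
  (forall i, (c i + s i) / 2 < b i < K - (c i + s i) / 2) ->
  (N.+1 < m * n)%N.
Proof.
move=> m2 n2 Mm Kn K2 hb.
have hb1 i : (c i + s i) / 2 < b i by case/andP: (hb i).
have hb2 i : (c i + s i) / 2 < K - b i by case/andP: (hb i); lra.
pose L : pred 'I_N := [pred i | b i <= 1].
pose U : pred 'I_N := [pred i | K - b i <= 1].
have cL : (#|L| <= m.-1)%N.
  by apply: (card_chord_ge1 (y := 9 / 10)) => // i; exact: chord_ge1.
have cU : (#|U| <= m.-1)%N.
  apply: (card_chord_ge1 (y := K - 9 / 10)) => // i Ui.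
  have -> : K - 9 / 10 - b i = - (9 / 10 - (K - b i)) by ring.
  by rewrite chordN; exact: chord_ge1.
have [n3|] := leqP 3 n; last first.
  (* Since [K < 2], every square is in [L] or [U], so [N <= 2 * (m - 1)]. *)
  rewrite ltnS => n2'; have n2E : n = 2 by apply/eqP; rewrite eqn_leq n2' n2.
  have : (N <= #|L| + #|U|)%N.
    rewrite -cardUI -[X in (X <= _)%N](card_ord N).
    apply: leq_trans (leq_addr _ _); apply: subset_leq_card.
    apply/fintype.subsetP => i _; rewrite !inE /=.
    by move: Kn; rewrite n2E; case: (lerP (b i) 1) => //=; lra.
  rewrite n2E; move: cL cU m2; clear; case: m => // m /=.
  move=> xm ym _ /leq_trans h; rewrite muln2 doubleS !ltnS -addnn.
  by apply: h; exact: leq_add.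
have {}K2 := K2 n3.
have aL i : area (c i) (s i) (1 - b i)
    <= ((L i)%:R + chord (c i) (s i) (1 - b i)) / 2.
  rewrite /L /=; case: (lerP (b i) 1) => h; first exact: area_le_chord.
  by rewrite add0r; apply: area_le_halfchord => //; lra.
have aU i : 1 - area (c i) (s i) (K - 1 - b i)
    <= ((U i)%:R + chord (c i) (s i) (K - 1 - b i)) / 2.
  have -> : K - 1 - b i = - (1 - (K - b i)) by ring.
  rewrite areaN chordN subKr /U /=.
  case: (lerP (K - b i) 1) => h; first exact: area_le_chord.
  by rewrite add0r; apply: area_le_halfchord => //; lra.
have sumb (P : pred 'I_N) : \sum_i (P i)%:R = #|P|%:R :> R.
  rewrite -sum1_card natr_sum [RHS]big_mkcond /=.
  by apply: eq_bigr => i _; rewrite unfold_in; case: (P i).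
have sL : \sum_i area (c i) (s i) (1 - b i) <= (#|L|%:R + M) / 2.
  apply: (le_trans (ler_sum _ (fun i _ => aL i))).
  by rewrite -mulr_suml big_split /= sumb; have := sum_chord_le 1; lra.
have sU : N%:R - \sum_i area (c i) (s i) (K - 1 - b i) <= (#|U|%:R + M) / 2.
  have -> : N%:R = \sum_(i < N) 1 :> R by rewrite sumr_const card_ord.
  rewrite -sumrB; apply: (le_trans (ler_sum _ (fun i _ => aU i))).
  by rewrite -mulr_suml big_split /= sumb; have := sum_chord_le (K - 1); lra.
have sM : \sum_i area (c i) (s i) (K - 1 - b i)
    - \sum_i area (c i) (s i) (1 - b i) <= M * (K - 2).
  have -> : K - 2 = (K - 1) - 1 by ring.
  by apply: sum_area_le; lra.
have rL : #|L|%:R <= m%:R - 1 :> R.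
  by rewrite lerBrDr natr1 ler_nat -(prednK (ltnW m2)).
have rU : #|U|%:R <= m%:R - 1 :> R.
  by rewrite lerBrDr natr1 ler_nat -(prednK (ltnW m2)).
rewrite -(ltr_nat R) natrM -natr1.
(* Adding [sL], [sM] and [sU] gives [N <= m - 1 + M * (K - 1)], which is less than
   [m - 1 + m * (n - 1) = m * n - 1]. *)
have : M * (K - 1) < m%:R * (n%:R - 1).
  by apply: ltr_pM; [exact: ltW| |exact: Mm|]; lra.
lra.
Qed.
End Packing.

(** * Rotations and the frame of the rectangle *)

Lemma rotation_rotation (R : realType) (t1 t2 : R) (p : R * R) :
  rotation t1 (rotation t2 p) = rotation (t1 + t2) p.
Proof. by rewrite /rotation /= sinD cosD; congr (_, _); ring. Qed.

Lemma rotationD (R : realType) (t : R) (p q : R * R) :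
  rotation t (p + q) = rotation t p + rotation t q.
Proof. by rewrite /rotation /=; congr (_, _) => /=; ring. Qed.

Lemma rotation0 (R : realType) (p : R * R) : rotation 0 p = p.
Proof.
by case: p => x y; rewrite /rotation /= sin0 cos0; congr (_, _); ring.
Qed.

Lemma rotationNK (R : realType) (t : R) : cancel (rotation (- t)) (rotation t).
Proof. by move=> p; rewrite rotation_rotation subrr rotation0. Qed.

Lemma rotationK (R : realType) (t : R) : cancel (rotation t) (rotation (- t)).
Proof. by move=> p; rewrite rotation_rotation addNr rotation0. Qed.

Lemma open_affine_itv (R : realType) (c1 c2 k : R) :
  open [set z : R * R | 0 < c1 * z.1 + c2 * z.2 + k < 1].
Proof.
pose f (z : R * R) := c1 * z.1 + c2 * z.2 + k.
have -> : [set z : R * R | 0 < c1 * z.1 + c2 * z.2 + k < 1] =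
    f @^-1` `]0, 1[%classic by apply/seteqP; split=> z /=; rewrite in_itv.
apply: open_comp; last exact: itv_open.
move=> z _.
have h1 : c1 * x.1 @[x --> z] --> c1 * z.1.
  by apply: cvgM; [exact: cvg_cst | exact: cvg_fst].
have h2 : c2 * x.2 @[x --> z] --> c2 * z.2.
  by apply: cvgM; [exact: cvg_cst | exact: cvg_snd].
exact: (cvgD (cvgD h1 h2) (cvg_cst k)).
Qed.

(** A quarter turn of [(C, S)] exchanges the two coordinates along the sides up to sign. The four
    sign patterns tell which turn leads to the first quadrant. *)
Lemma quarter_turn (R : realType) (C S : R) : C ^+ 2 + S ^+ 2 = 1 ->
  exists c s, direction c s /\ forall x y,
    (`|C * x + S * y| = `|c * x + s * y| /\
     `|C * y - S * x| = `|c * y - s * x|) \/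
    (`|C * x + S * y| = `|c * y - s * x| /\
     `|C * y - S * x| = `|c * x + s * y|).
Proof.
move=> CS; case: (lerP 0 C) => C0; case: (lerP 0 S) => S0.
- by exists C, S; split=> // x y; left.
- exists (- S), C; split; first by split; rewrite ?sqrrN; lra.
  move=> x y; right; split; last by congr `|_|; ring.
  by rewrite -normrN; congr `|_|; ring.
- exists S, (- C); split; first by split; rewrite ?sqrrN; lra.
  move=> x y; right; split; first by congr `|_|; ring.
  by rewrite -normrN; congr `|_|; ring.
- exists (- C), (- S); split; first by split; rewrite ?sqrrN; lra.
  by move=> x y; left; split; rewrite -normrN; congr `|_|; ring.
Qed.

(* In the frame of the rectangle [Q] (rotated by [t0] and translated by [v0])
   a unit square is centred at some [(a, b)]; a quarter turn makes the
   direction of its sides lie in the first quadrant. *)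
Lemma unit_square_frame (R : realType) (A : set (R * R)) (t0 : R)
    (v0 : R * R) : is_unit_square A ->
  exists (c s a b : R), [/\ direction c s,
    forall x y, `|c * (x - a) + s * (y - b)| <= 1 / 2 ->
      `|c * (y - b) - s * (x - a)| <= 1 / 2 -> A (rotation t0 (x, y) + v0)
  & forall x y, in_open_square c s (x - a) (y - b) ->
      interior A (rotation t0 (x, y) + v0)].
Proof.
move=> [t [v AE]].
(* Coordinates in which [A] is the square [[0, 1] x [0, 1]]. *)
pose P z : R * R := rotation (- t) (z - v).
have PA z : 0 <= (P z).1 <= 1 -> 0 <= (P z).2 <= 1 -> A z.
  move=> h1 h2; rewrite AE; exists (P z); last by rewrite rotationNK subrK.
  by split; rewrite /= in_itv.
have PI z : 0 < (P z).1 < 1 -> 0 < (P z).2 < 1 -> interior A z.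
  move=> h1 h2.
  pose U := [set z | 0 < (P z).1 < 1] `&` [set z | 0 < (P z).2 < 1].
  have Uo : open U.
    have P1 x : (P x).1 = cos t * x.1 + sin t * x.2
        + (- cos t * v.1 - sin t * v.2).
      by rewrite /P /rotation /= cosN sinN; ring.
    have P2 x : (P x).2 = - sin t * x.1 + cos t * x.2
        + (sin t * v.1 - cos t * v.2).
      by rewrite /P /rotation /= cosN sinN; ring.
    rewrite /U; under eq_set do rewrite P1.
    under [X in _ `&` X]eq_set do rewrite P2.
    by apply: openI; exact: open_affine_itv.
  have UA : U `<=` A.
    move=> q [/= /andP[? ?] /andP[? ?]].
    by apply: PA; apply/andP; split; exact: ltW.
  by move: UA; rewrite open_subsetE // => /(_ z); apply.
pose u := rotation (- t0) (v0 - v).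
have PE x y : P (rotation t0 (x, y) + v0) = rotation (- (t - t0)) ((x, y) + u).
  have -> : - (t - t0) = - t + t0 by ring.
  by rewrite -rotation_rotation rotationD rotationNK addrA.
move: u PE => [u1 u2] PE.
pose C := cos (t - t0); pose S := sin (t - t0).
have CS : C ^+ 2 + S ^+ 2 = 1 := cos2Dsin2 (t - t0).
have [c [s [d cs]]] := quarter_turn CS.
(* The centre: the point that [P] sends to [(1 / 2, 1 / 2)]. *)
pose a := (C - S) / 2 - u1; pose b := (S + C) / 2 - u2.
have P1 x y : (P (rotation t0 (x, y) + v0)).1 =
    1 / 2 + (C * (x - a) + S * (y - b)).
  rewrite PE /rotation /= cosN sinN -/C -/S /a /b.
  have -> : 1 / 2 = (C ^+ 2 + S ^+ 2) / 2 by rewrite CS.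
  by field.
have P2 x y : (P (rotation t0 (x, y) + v0)).2 =
    1 / 2 + (C * (y - b) - S * (x - a)).
  rewrite PE /rotation /= cosN sinN -/C -/S /a /b.
  have -> : 1 / 2 = (C ^+ 2 + S ^+ 2) / 2 by rewrite CS.
  by field.
exists c, s, a, b; split=> // x y.
  move=> h1 h2.
  have [] : `|C * (x - a) + S * (y - b)| <= 1 / 2 /\
      `|C * (y - b) - S * (x - a)| <= 1 / 2.
    by case: (cs (x - a) (y - b)) => -[-> ->].
  by rewrite !ler_norml => ? ?; apply: PA; rewrite ?P1 ?P2; lra.
move=> [h1 h2].
have [] : `|C * (x - a) + S * (y - b)| < 1 / 2 /\
    `|C * (y - b) - S * (x - a)| < 1 / 2.
  by case: (cs (x - a) (y - b)) => -[-> ->].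
by rewrite !ltr_norml => ? ?; apply: PI; rewrite ?P1 ?P2; lra.
Qed.

(** * Reduction to the packing bound *)

Theorem corollary6p1 (R : realType) (m n : nat) (hm : (2 <= m)%N)
    (hn : (2 <= n)%N) (m' n' : R) (hm'0 : 0 < m') (hn'0 : 0 < n')
    (hm' : m' < m%:R) (hn' : n' < n%:R)
    (Q : set (R * R)) (hQ : is_rectangle m' n' Q) :
  ~ exists S : 'I_(m * n - 1) -> set (R * R),
      [/\ forall i, is_unit_square (S i),
          forall i, S i `<=` Q
        & trivIset setT (fun i => interior (S i))].
Proof.
move=> [S [sqS SQ tS]]; have [t0 [v0 QE]] := hQ.
have inQ x y : Q (rotation t0 (x, y) + v0) -> 0 <= x <= m' /\ 0 <= y <= n'.
  rewrite QE => -[p [/= p1 p2]] /addIr /(can_inj (rotationK t0)) pE.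
  by move: p1 p2; rewrite pE !in_itv.
have /choice[c /choice[s /choice[a /choice[b fr]]]] :=
  fun i => unit_square_frame t0 v0 (sqS i).
(* A height strictly between [n'] and [n], and close enough to [n] that [2 <= K] once [3 <= n]. *)
pose K := (Num.max n' (n%:R - 1) + n%:R) / 2.
have [Kn' Kn Kn1] : [/\ n' < K, K < n%:R & n%:R - 1 / 2 <= K].
  by rewrite /K; case: (lerP n' (n%:R - 1)) => ?; split; lra.
(* Raising all squares by [h] leaves a positive margin both at the bottom and at the top of height
   [K]. *)
pose h := (K - n') / 2.
have inM i x y : in_open_square (c i) (s i) (x - a i) (y - (b i + h)) ->
    0 <= x <= m'.
  have [_ cl _] := fr i; rewrite opprD addrA -addrAC => -[h1 h2].
  by have [] := inQ _ _ (SQ i _ (cl _ _ (ltW h1) (ltW h2))).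
suff : ((m * n - 1).+1 < m * n)%N.
  by rewrite subn1 prednK ?ltnn // muln_gt0 !(leq_trans _ hm, leq_trans _ hn).
apply: (@packing_bound _ _ m' c s a (fun i => b i + h) _ _ inM _ m n K) => //.
- by move=> i; have [] := fr i.
- move=> i j x y; rewrite !opprD !addrA -!(addrAC y (- h)) => hi hj.
  have [[_ _ Ii] [_ _ Ij]] := (fr i, fr j).
  by apply: tS => //; exists (rotation t0 (x, y - h) + v0); split;
    [exact: Ii | exact: Ij].
- by rewrite -(ler_nat R) => n3; lra.
- move=> i; have [[c0 s0 cs] cl _] := fr i.
  (* The highest vertex for [e = 1] and the lowest for [e = -1]; both belong to the closed square,
     hence to [Q]. *)
  have vertex e : `|e| = 1 :> R ->
      0 <= b i + e * (c i + s i) / 2 <= n'.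
    move=> e1; have [] // := inQ (a i + e * (c i - s i) / 2)
      (b i + e * (c i + s i) / 2).
    apply: SQ; apply: cl; rewrite !(addrAC _ _ (- _)) !subrr !add0r.
      rewrite (_ : _ + _ = e * ((c i ^+ 2 + s i ^+ 2) / 2)); last by field.
      by rewrite cs normrM e1 mul1r ger0_norm //; lra.
    rewrite (_ : _ - _ = e * ((c i ^+ 2 + s i ^+ 2) / 2)); last by field.
    by rewrite cs normrM e1 mul1r ger0_norm //; lra.
  have := vertex 1 (normr1 _); have := vertex (-1) (normrN1 _).
  by rewrite /h; lra.
Qed.
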